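(* Let $\alpha\in\mathbb D$ and $0<w<1$, and define $$H_{\alpha,w}(z)=w\frac{1+z}{1-z}+(1-w)\frac{1+\alpha z}{1-\alpha z},\qquad F_{\alpha,w}=\frac{H_{\alpha,w}-1}{H_{\alpha,w}+1}.$$ Then $F_{\alpha,w}$ is a non-inner Schur function satisfying $F_{\alpha,w}(0)=0$, $F_{\alpha,w}(1)=1$, and $$\mathcal R(F_{\alpha,w})>0.$$
   Context: $\mathbb D$ is the open complex unit disk. A Schur function is an analytic function $F$ on $\mathbb D$ with $|F|\le1$; it is inner if its boundary values have modulus one almost everywhere. For $F$ analytic in a neighborhood of $\overline{\mathbb D}$, put $G(z)=zF'(z)$ and define $$\mathcal R(F)=\left.\frac1{4\pi}\int_0^{2\pi}\bigl(1-\mathrm{Re}\,F(re^{i\theta})\bigr)\,\partial_r\bigl|G(re^{i\theta})\bigr|^2\,d\theta\right|_{r=1}.$$ (The function $F_{\alpha,w}$ is rational and extends analytically to a neighborhood of $\overline{\mathbb D}$.) *)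

(* Defs.v *)
From HB Require Import structures.
From mathcomp Require Import all_boot all_order all_algebra.
From mathcomp Require Import complex.
From mathcomp Require Import all_classical all_reals all_analysis.

Set Implicit Arguments.
Unset Strict Implicit.
Unset Printing Implicit Defensive.

Import Order.TTheory GRing.Theory Num.Theory.
Import numFieldNormedType.Exports.

Local Open Scope ring_scope.
Local Open Scope complex_scope.
Local Open Scope classical_set_scope.

(* [R[i]] as a normed module over itself, so that [derivable f z 1] and
   [derive1 f z] are the complex differentiability and derivative of
   [f : R[i] -> R[i]]. *)
HB.instance Definition _ (R : realType) := NormedModule.copy R[i] R[i]^o.

Definition unit_disk {R : realType} : set R[i] := [set z | `|z| < 1].

Definition closed_unit_disk {R : realType} : set R[i] := [set z | `|z| <= 1].

(* The point r e^{it}. *)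
Definition polar {R : realType} (r t : R) : R[i] :=
  (r * cos t) +i* (r * sin t).

(* The modulus as an element of R; on [R[i]], [`|z|] has type [R[i]]. *)
Definition modulus {R : realType} (z : R[i]) : R := complex.Re `|z|.

(* Meant for open sets [U]. *)
Definition analytic_on {R : realType} (U : set R[i]) (F : R[i] -> R[i]) : Prop :=
  forall z, U z -> derivable F z 1.

Definition analytic_near_closed_disk {R : realType} (F : R[i] -> R[i]) : Prop :=
  exists U : set R[i],
    [/\ open U, closed_unit_disk `<=` U & analytic_on U F].

Definition schur_function {R : realType} (F : R[i] -> R[i]) : Prop :=
  analytic_on unit_disk F /\ forall z, unit_disk z -> `|F z| <= 1.

(* The boundary values are the radial limits F(r e^{it}), r -> 1-. *)
Definition inner_function {R : realType} (F : R[i] -> R[i]) : Prop :=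
  schur_function F /\
  {ae (@lebesgue_measure R), forall t : R, `[0, 2 * pi] t ->
     exists2 l : R[i], F (polar r t) @[r --> (1 : R)^'-] --> l & `|l| = 1}.

Definition zderiv {R : realType} (F : R[i] -> R[i]) (z : R[i]) : R[i] :=
  z * derive1 F z.

Definition calR_at {R : realType} (F : R[i] -> R[i]) (r : R) : R :=
  (4 * pi)^-1 *
  \int[@lebesgue_measure R]_(t in `[0, 2 * pi])
    ((1 - complex.Re (F (polar r t))) *
     derive1 (fun s : R => modulus (zderiv F (polar s t)) ^+ 2) r).

Definition calR {R : realType} (F : R[i] -> R[i]) : R := calR_at F 1.

Definition Hfun {R : realType} (alpha : R[i]) (w : R) (z : R[i]) : R[i] :=
  w%:C * ((1 + z) / (1 - z)) +
  (1 - w)%:C * ((1 + alpha * z) / (1 - alpha * z)).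

(* F_{alpha,w} = (H - 1) / (H + 1) as a rational function: H has poles at
   z = 1 and z = 1/alpha, which are removable singularities of the quotient,
   whereas division by zero returns 0 in the library.  Taking the limit over
   the punctured neighbourhood removes them, and leaves the value of the
   quotient unchanged wherever H and the quotient have no pole. *)
Definition Ffun {R : realType} (alpha : R[i]) (w : R) (z : R[i]) : R[i] :=
  lim ((Hfun alpha w u - 1) / (Hfun alpha w u + 1) @[u --> z^']).

(* Main.v *)
Require Import Defs.
From mathcomp Require Import all_boot all_order all_algebra.
From mathcomp Require Import complex.
From mathcomp Require Import all_classical all_reals all_analysis.
From mathcomp Require Import ring lra.

(** Write b = w alpha + (1 - w), g = w + (1 - w) alpha, d = 1 - b,
    l = (1 - w) / w and v = 1 / (1 - b z).  Clearing denominators in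
    (H - 1) / (H + 1) removes the poles at 1 and at 1 / alpha and leaves
        F = z (g - alpha z) / (1 - b z) = g z + k z^2 v,
    with k = g b - alpha; moreover g = 1 - l d and k = l d^2.  Since
    |b| < 1, this is analytic near the closed disk, and the values at 0 and 1
    are read off.  The identity
        |1 - b z|^2 - |z (g - alpha z)|^2 = w (1 - |z|^2) |1 - alpha z|^2
                               + (1 - w) (1 - |alpha z|^2) |1 - z|^2
    ([schur_identity]) gives |F| <= 1 on the closed disk and |F| < 1 at every
    point of the circle other than 1, so F is Schur and not inner.

    The functional.  Let E be the Euler operator z d/dz, and G = E F, K = E G,
    L = E K.  On the circle the radial derivative of |G|^2 is 2 Re(conj G K),
    hence R(F) is the mean over the circle of (1 - Re F) Re(conj G K).
    As d/dt = i E along the circle, every such mean can be integrated by parts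
    without boundary terms; doing so until conj F is the only conjugated
    factor turns the mean into that of Re(conj F B) with
    B = (1 - F) L - 2 G K, a function analytic near the closed disk
    ([circle_mean_integrand]).  Now B = g z + z^2 C with C a polynomial in z and
    v, and conj(z^2 v) paired with z^2 C is the Szego kernel at conj b: it
    reproduces the value C(conj b) ([reproduced_mono]).  Therefore
        R(F) = |g|^2 + Re (conj k C(conj b))     ([calR_Ffrac]).
    No contour integration enters: a function is said to have mean m when
    f - m has a periodic primitive, and the only primitive that is not rational
    in z, v and their conjugates is that of v - 1, namely i log (1 - b z).

    Positivity.  With D = 1 - |b|^2, Y = |d|^2, X = D^2 / Y and mu = l Y / D,
    the value above is affine in X and Y with coefficients depending on D and mu
    ([Re_mean_eq_mean_value]), and the data satisfy 0 < D <= 1, 0 < mu < 1, Y > 0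
    and X + Y + 2 D <= 4.  The coefficient of X is nonpositive and at most that
    of Y, so the value is bounded below by the one at X = 4 - 2 D, Y = 0; for each
    mu the latter is smallest at D = 1, where it equals
    1 - 6 mu + 17/2 mu^2 + 9/2 mu^3 > 0 ([mean_value_gt0]). *)

Import Order.TTheory GRing.Theory Num.Theory.
Import numFieldNormedType.Exports.

Local Open Scope ring_scope.
Local Open Scope complex_scope.
Local Open Scope classical_set_scope.

Set Implicit Arguments.
Unset Strict Implicit.
Unset Printing Implicit Defensive.

(** * Derivatives of complex-valued functions of a real variable *)

Section ComplexParts.
Variable R : realType.
Implicit Types x y : R[i].

Lemma complex_eq x y :
  complex.Re x = complex.Re y -> complex.Im x = complex.Im y -> x = y.
Proof. by case: x => a b; case: y => c d /= -> ->. Qed.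

Lemma complexReM x y : complex.Re (x * y) =
  complex.Re x * complex.Re y - complex.Im x * complex.Im y.
Proof. by case: x; case: y. Qed.

Lemma complexImM x y : complex.Im (x * y) =
  complex.Re x * complex.Im y + complex.Im x * complex.Re y.
Proof. by case: x; case: y. Qed.

Lemma complexReD x y : complex.Re (x + y) = complex.Re x + complex.Re y.
Proof. by case: x; case: y. Qed.

Lemma complexImD x y : complex.Im (x + y) = complex.Im x + complex.Im y.
Proof. by case: x; case: y. Qed.

Lemma complexReN x : complex.Re (- x) = - complex.Re x.
Proof. by case: x. Qed.

Lemma complexImN x : complex.Im (- x) = - complex.Im x.
Proof. by case: x. Qed.

(** The squared modulus as a real number; the norm of a complex number is itself
    an element of the complex field. *)
Definition normsq x : R := complex.Re x ^+ 2 + complex.Im x ^+ 2.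

Lemma normsqE x : (normsq x)%:C = x * x^*%C.
Proof.
case: x => a b; apply: complex_eq;
  by rewrite ?complexReM ?complexImM /normsq /=; ring.
Qed.

Lemma normsq_ge0 x : 0 <= normsq x.
Proof. by rewrite addr_ge0 ?sqr_ge0. Qed.

Lemma normsq_eq0 x : (normsq x == 0) = (x == 0).
Proof.
by case: x => a b;
  rewrite /normsq /= paddr_eq0 ?sqr_ge0 // !sqrf_eq0 eq_complex.
Qed.

Lemma normsq_gt0 x : x != 0 -> 0 < normsq x.
Proof. by move=> x0; rewrite lt_def normsq_eq0 x0 normsq_ge0. Qed.

Lemma complexReV x : complex.Re x^-1 = complex.Re x / normsq x.
Proof. by case: x. Qed.

Lemma complexImV x : complex.Im x^-1 = - complex.Im x / normsq x.
Proof. by case: x => a b /=; rewrite mulNr. Qed.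

End ComplexParts.

Section Curves.
Variable R : realType.
Local Notation C := R[i].
Implicit Types (f g : R -> C) (t : R) (c d m : C).

(** Differentiability is expressed through the real and imaginary parts because
    the complex field carries its normed-module structure over itself only, not
    over the reals. *)
Definition curve_deriv f t d : Prop :=
  is_derive t (1 : R) (fun s => complex.Re (f s)) (complex.Re d) /\
  is_derive t (1 : R) (fun s => complex.Im (f s)) (complex.Im d).

Lemma curve_deriv_eq f t d d' : curve_deriv f t d -> d = d' -> curve_deriv f t d'.
Proof. by move=> h <-. Qed.

Lemma curve_deriv_ext f g t d : f =1 g -> curve_deriv f t d -> curve_deriv g t d.
Proof. by move=> /funext <-. Qed.

Lemma curve_deriv_cst c t : curve_deriv (fun=> c) t 0.
Proof. by split; exact: is_derive_cst. Qed.

Lemma curve_derivD f g t d e : curve_deriv f t d -> curve_deriv g t e ->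
  curve_deriv (fun s => f s + g s) t (d + e).
Proof.
move=> [hf1 hf2] [hg1 hg2]; split.
  rewrite complexReD (_ : (fun _ => _) =
    (fun s => complex.Re (f s)) + (fun s => complex.Re (g s))).
    exact: is_deriveD.
  by apply/funext => s; rewrite complexReD.
rewrite complexImD (_ : (fun _ => _) =
    (fun s => complex.Im (f s)) + (fun s => complex.Im (g s))).
  exact: is_deriveD.
by apply/funext => s; rewrite complexImD.
Qed.

Lemma curve_derivM f g t d e : curve_deriv f t d -> curve_deriv g t e ->
  curve_deriv (fun s => f s * g s) t (d * g t + f t * e).
Proof.
move=> [hf1 hf2] [hg1 hg2]; split.
  rewrite (_ : (fun _ => _) = (fun s => complex.Re (f s)) * (fun s => complex.Re (g s))
     - (fun s => complex.Im (f s)) * (fun s => complex.Im (g s))).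
    apply: is_derive_eq (is_deriveB (is_deriveM hf1 hg1) (is_deriveM hf2 hg2)) _.
    by rewrite !(complexReD, complexReM) /GRing.scale /=; ring.
  by apply/funext => s; rewrite complexReM.
rewrite (_ : (fun _ => _) = (fun s => complex.Re (f s)) * (fun s => complex.Im (g s))
     + (fun s => complex.Im (f s)) * (fun s => complex.Re (g s))).
  apply: is_derive_eq (is_deriveD (is_deriveM hf1 hg2) (is_deriveM hf2 hg1)) _.
  by rewrite !(complexImD, complexImM) /GRing.scale /=; ring.
by apply/funext => s; rewrite complexImM.
Qed.

Lemma curve_derivZ c f t d : curve_deriv f t d ->
  curve_deriv (fun s => c * f s) t (c * d).
Proof.
move=> hf; apply: (curve_deriv_eq (curve_derivM (curve_deriv_cst c t) hf)).
by rewrite mul0r add0r.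
Qed.

Lemma curve_derivN f t d : curve_deriv f t d -> curve_deriv (fun s => - f s) t (- d).
Proof.
move=> hf; rewrite -mulN1r; apply: (curve_deriv_ext _ (curve_derivZ (-1) hf)) => s.
by rewrite mulN1r.
Qed.

Lemma curve_derivB f g t d e : curve_deriv f t d -> curve_deriv g t e ->
  curve_deriv (fun s => f s - g s) t (d - e).
Proof. by move=> hf hg; exact: curve_derivD hf (curve_derivN hg). Qed.

Lemma curve_deriv_conj f t d : curve_deriv f t d ->
  curve_deriv (fun s => (f s)^*%C) t d^*%C.
Proof.
have ReC (x : C) : complex.Re x^*%C = complex.Re x by case: x.
have ImC (x : C) : complex.Im x^*%C = - complex.Im x by case: x.
move=> [hf1 hf2]; split.
  by rewrite ReC (_ : (fun _ => _) = (fun s => complex.Re (f s))) //; apply/funext => s.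
rewrite ImC (_ : (fun _ => _) = - (fun s => complex.Im (f s))).
  exact: is_deriveN.
by apply/funext => s.
Qed.

Lemma curve_derivX f t d k : curve_deriv f t d ->
  curve_deriv (fun s => f s ^+ k) t (k%:R * f t ^+ k.-1 * d).
Proof.
move=> hf; elim: k => [|k IH].
  by apply: (curve_deriv_eq (curve_deriv_cst 1 t)); rewrite !mul0r.
apply: (@curve_deriv_ext (fun s => f s * f s ^+ k)); first by move=> s; rewrite exprS.
apply: (curve_deriv_eq (curve_derivM hf IH)).
case: k {IH} => [|k] /=; first by rewrite !expr0; ring.
by rewrite exprS -(natr1 k.+1); ring.
Qed.

Lemma is_derive_normsq f t d : curve_deriv f t d ->
  is_derive t (1 : R) (fun s => normsq (f s))
    (2 * complex.Re (f t) * complex.Re d + 2 * complex.Im (f t) * complex.Im d).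
Proof.
move=> [hf1 hf2].
rewrite (_ : (fun _ => _) = (fun s => complex.Re (f s)) * (fun s => complex.Re (f s))
      + (fun s => complex.Im (f s)) * (fun s => complex.Im (f s))).
  apply: is_derive_eq (is_deriveD (is_deriveM hf1 hf1) (is_deriveM hf2 hf2)) _.
  by rewrite /GRing.scale /=; ring.
by apply/funext => s; rewrite /normsq !expr2.
Qed.

Lemma curve_derivV f t d : f t != 0 -> curve_deriv f t d ->
  curve_deriv (fun s => (f s)^-1) t (- d / f t ^+ 2).
Proof.
move=> f0 [hf1 hf2].
have n0 : normsq (f t) != 0 by rewrite normsq_eq0.
have hn := is_derive_normsq (conj hf1 hf2).
have hnV := @is_deriveV R (fun s => normsq (f s)) _ _ _ n0 hn.
have -> : - d / f t ^+ 2 = - d * (f t)^-1 * (f t)^-1 by rewrite expr2 invfM mulrA.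
split.
  rewrite (_ : (fun _ => _) =
    (fun s => complex.Re (f s)) * (fun s => (normsq (f s))^-1)); last first.
    by apply/funext => s; rewrite complexReV.
  apply: is_derive_eq; rewrite /GRing.scale /=.
  rewrite !(complexReM, complexImM, complexReV, complexImV, complexReN, complexImN).
  move: n0; rewrite /normsq; move: (complex.Re (f t)) (complex.Im (f t)) => a b n0.
  by field.
rewrite (_ : (fun _ => _) =
    - ((fun s => complex.Im (f s)) * (fun s => (normsq (f s))^-1))); last first.
  by apply/funext => s; rewrite complexImV mulNr.
apply: is_derive_eq; rewrite /GRing.scale /=.
rewrite !(complexReM, complexImM, complexReV, complexImV, complexReN, complexImN).
move: n0; rewrite /normsq; move: (complex.Re (f t)) (complex.Im (f t)) => a b n0.
by field.
Qed.

End Curves.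

(** * Euler derivatives and means over the unit circle *)

Section EulerDerivatives.
Variable R : realType.
Local Notation C := R[i].
Variables b g k : C.

Definition pole (z : C) : C := (1 - b * z)^-1.

(** [Gfrac], [Kfrac] and [Lfrac] are the successive images of [Ffrac] under the
    Euler operator z d/dz.  Since z d/dz maps v = 1 / (1 - b z) to v^2 - v, all
    four are g z + k z^2 p(v) with a polynomial p, and b never has to be inverted. *)
Definition Ffrac (z : C) : C := g * z + k * z ^+ 2 * pole z.
Definition Gfrac (z : C) : C := g * z + k * z ^+ 2 * (pole z + pole z ^+ 2).
Definition Kfrac (z : C) : C :=
  g * z + k * z ^+ 2 * (pole z + pole z ^+ 2 + 2 * pole z ^+ 3).
Definition Lfrac (z : C) : C :=
  g * z + k * z ^+ 2 * (pole z + pole z ^+ 2 + 6 * pole z ^+ 4).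

Variables (z : R -> C) (eta : C) (t : R).
Hypothesis hz : curve_deriv z t (eta * z t).
Hypothesis pole0 : 1 - b * z t != 0.

(** A curve with z' = eta z covers both uses: eta = i for the circle, where the
    parameter is the angle, and eta = 1 for a ray at radius one. *)
Lemma curve_deriv_pole :
  curve_deriv (fun s => pole (z s)) t (eta * (pole (z t) ^+ 2 - pole (z t))).
Proof.
have h := curve_derivB (curve_deriv_cst 1 t) (curve_derivZ b hz).
apply: (curve_deriv_eq (curve_derivV pole0 h)).
by rewrite /pole; field.
Qed.

Lemma curve_deriv_mono a n :
  curve_deriv (fun s => z s ^+ a * pole (z s) ^+ n) t
    (eta * (a%:R * (z t ^+ a * pole (z t) ^+ n) +
     n%:R * (z t ^+ a * (pole (z t) ^+ n.+1 - pole (z t) ^+ n)))).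
Proof.
apply: (curve_deriv_eq (curve_derivM (curve_derivX a hz)
  (curve_derivX n curve_deriv_pole))).
have mulX (x : C) m : m%:R * x ^+ m.-1 * x = m%:R * x ^+ m.
  by case: m => [|m]; rewrite ?mul0r // exprSr mulrA.
have -> : a%:R * z t ^+ a.-1 * (eta * z t) = eta * (a%:R * z t ^+ a).
  by rewrite -mulX; ring.
have -> : n%:R * pole (z t) ^+ n.-1 * (eta * (pole (z t) ^+ 2 - pole (z t))) =
  eta * (n%:R * pole (z t) ^+ n * (pole (z t) - 1)) by rewrite -mulX; ring.
rewrite exprS; ring.
Qed.

Lemma curve_deriv_scaled_mono c a n d :
  d = eta * (c * (a%:R * (z t ^+ a * pole (z t) ^+ n) +
     n%:R * (z t ^+ a * (pole (z t) ^+ n.+1 - pole (z t) ^+ n)))) ->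
  curve_deriv (fun s => c * z s ^+ a * pole (z s) ^+ n) t d.
Proof.
move=> ->; apply: (@curve_deriv_ext _ (fun s => c * (z s ^+ a * pole (z s) ^+ n))).
  by move=> s; rewrite mulrA.
by apply: (curve_deriv_eq (curve_derivZ c (curve_deriv_mono a n))); ring.
Qed.

Lemma curve_deriv_F : curve_deriv (fun s => Ffrac (z s)) t (eta * Gfrac (z t)).
Proof.
apply: (@curve_deriv_ext _ (fun s => g * z s + k * z s ^+ 2 * pole (z s) ^+ 1)).
  by move=> s.
apply: (curve_deriv_eq (curve_derivD (curve_derivZ g hz)
  (@curve_deriv_scaled_mono k 2 1 _ erefl))).
by rewrite /Gfrac; ring.
Qed.

Lemma curve_deriv_G : curve_deriv (fun s => Gfrac (z s)) t (eta * Kfrac (z t)).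
Proof.
apply: (@curve_deriv_ext _ (fun s => g * z s +
  (k * z s ^+ 2 * pole (z s) ^+ 1 + k * z s ^+ 2 * pole (z s) ^+ 2))).
  by move=> s; rewrite /Gfrac; ring.
apply: (curve_deriv_eq (curve_derivD (curve_derivZ g hz)
  (curve_derivD (@curve_deriv_scaled_mono k 2 1 _ erefl)
    (@curve_deriv_scaled_mono k 2 2 _ erefl)))).
by rewrite /Kfrac; ring.
Qed.

Lemma curve_deriv_K : curve_deriv (fun s => Kfrac (z s)) t (eta * Lfrac (z t)).
Proof.
apply: (@curve_deriv_ext _ (fun s => g * z s +
  (k * z s ^+ 2 * pole (z s) ^+ 1 + (k * z s ^+ 2 * pole (z s) ^+ 2
   + 2 * k * z s ^+ 2 * pole (z s) ^+ 3)))).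
  by move=> s; rewrite /Kfrac; ring.
apply: (curve_deriv_eq (curve_derivD (curve_derivZ g hz)
  (curve_derivD (@curve_deriv_scaled_mono k 2 1 _ erefl)
  (curve_derivD (@curve_deriv_scaled_mono k 2 2 _ erefl)
    (@curve_deriv_scaled_mono (2 * k) 2 3 _ erefl))))).
by rewrite /Lfrac; ring.
Qed.

End EulerDerivatives.

Section CircleMeans.
Variable R : realType.
Local Notation C := R[i].
Implicit Types (f h : R -> C) (m : C).

Definition ucircle (t : R) : C := polar 1 t.

Lemma curve_deriv_ucircle t : curve_deriv ucircle t ('i * ucircle t).
Proof.
split=> /=.
  rewrite (_ : (fun _ => _) = cos); last by apply/funext => s; rewrite mul1r.
  by apply: is_derive_eq (is_derive_cos t) _; ring.
rewrite (_ : (fun _ => _) = sin); last by apply/funext => s; rewrite mul1r.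
by apply: is_derive_eq (is_derive_sin t) _; ring.
Qed.

Lemma curve_deriv_ray (t : R) :
  curve_deriv (fun s => polar s t) 1 (1 * polar 1 t).
Proof.
have h (c : R) : is_derive (1 : R) (1 : R) (fun s => s * c) c.
  apply: is_derive_eq (is_deriveM (is_derive_id _ _) (is_derive_cst c _ _)) _.
  by rewrite /GRing.scale /=; ring.
by split; rewrite mul1r /= mul1r; exact: h.
Qed.

Lemma normsq_ucircle t : normsq (ucircle t) = 1.
Proof. by rewrite /normsq /= !mul1r cos2Dsin2. Qed.

Lemma ucircleK t : ucircle t * (ucircle t)^*%C = 1.
Proof. by rewrite -normsqE normsq_ucircle. Qed.

Lemma ucircle_2pi : ucircle (2 * pi) = ucircle 0.
Proof. by rewrite /ucircle /polar mulr_natl cos2pi sin2pi cos0 sin0. Qed.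

(** A mean certified by a periodic primitive of f - m: this yields the integral
    by the fundamental theorem of calculus, and turns integration by parts and
    linearity into operations on primitives. *)
Definition circle_mean f m : Prop :=
  exists2 P : R -> C, P (2 * pi) = P 0 & forall t, curve_deriv P t (f t - m).

Lemma circle_mean_ext f h m : f =1 h -> circle_mean f m -> circle_mean h m.
Proof. by move=> /funext <-. Qed.

Lemma circle_mean_eq f m m' : circle_mean f m -> m = m' -> circle_mean f m'.
Proof. by move=> ? <-. Qed.

Lemma circle_mean_cst m : circle_mean (fun=> m) m.
Proof. by exists (fun=> 0) => // t; rewrite subrr; exact: curve_deriv_cst. Qed.

Lemma circle_meanD f h m n : circle_mean f m -> circle_mean h n ->
  circle_mean (fun t => f t + h t) (m + n).
Proof.
move=> [P P0 hP] [Q Q0 hQ]; exists (fun t => P t + Q t) => [|t].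
  by rewrite P0 Q0.
by apply: (curve_deriv_eq (curve_derivD (hP t) (hQ t))); ring.
Qed.

Lemma circle_meanZ c f m : circle_mean f m -> circle_mean (fun t => c * f t) (c * m).
Proof.
move=> [P P0 hP]; exists (fun t => c * P t) => [|t]; first by rewrite P0.
by apply: (curve_deriv_eq (curve_derivZ c (hP t))); ring.
Qed.

Lemma circle_mean_conj f m : circle_mean f m ->
  circle_mean (fun t => (f t)^*%C) m^*%C.
Proof.
move=> [P P0 hP]; exists (fun t => (P t)^*%C) => [|t]; first by rewrite P0.
by apply: (curve_deriv_eq (curve_deriv_conj (hP t))); rewrite rmorphB.
Qed.

(** The Euler derivative of a function on the circle has mean zero, as d/dt is
    i times the Euler operator there. *)
Lemma circle_mean_deriv (P f : R -> C) : P (2 * pi) = P 0 ->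
  (forall t, curve_deriv P t ('i * f t)) -> circle_mean f 0.
Proof.
move=> P0 hP; exists (fun t => - 'i * P t) => [|t]; first by rewrite P0.
apply: (curve_deriv_eq (curve_derivZ (- 'i) (hP t))).
by rewrite mulrA mulNr -expr2 sqr_i opprK mul1r subr0.
Qed.

End CircleMeans.

(** * Means of monomials and the reproducing property *)

Section CircleMeansOfPoles.
Variable R : realType.
Local Notation C := R[i].

(** The principal logarithm, written out as ln |f| + i atan (Im f / Re f), which is
    valid on the right half-plane. *)
Lemma curve_deriv_log (f : R -> C) (t : R) (d : C) :
  0 < complex.Re (f t) -> curve_deriv f t d ->
  curve_deriv (fun s => (ln (normsq (f s)) / 2) +i*
                        atan (complex.Im (f s) / complex.Re (f s))) t (d / f t).
Proof.
move=> r0 [hf1 hf2].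
have r1 : complex.Re (f t) != 0 by rewrite gt_eqF.
have n0 : 0 < normsq (f t) by rewrite ltr_pwDl ?exprn_gt0 // sqr_ge0.
have n1 : normsq (f t) != 0 by rewrite gt_eqF.
have hn := is_derive_normsq (conj hf1 hf2).
split.
  rewrite (_ : (fun _ => _) = (@ln R \o (fun s => normsq (f s))) * cst 2^-1) //.
  have h1 := @is_derive1_comp _ (@ln R) (fun s => normsq (f s)) t _ _
    (is_derive1_ln n0) hn.
  have h2 := is_deriveM h1 (is_derive_cst (2^-1 : R) t 1).
  apply: (is_derive_eq h2).
  rewrite !(complexReM, complexImM, complexReV, complexImV) /GRing.scale /=.
  move: n1; rewrite /normsq; move: (complex.Re (f t)) (complex.Im (f t)) => x y n1.
  by field.
rewrite (_ : (fun _ => _) = @atan R \o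
  ((fun s => complex.Im (f s)) * (fun s => (complex.Re (f s))^-1))) //.
have h1 := is_deriveM hf2 (@is_deriveV R (fun s => complex.Re (f s)) _ _ _ r1 hf1).
have h2 := @is_derive1_comp _ (@atan R) ((fun s => complex.Im (f s)) *
  (fun s => (complex.Re (f s))^-1)) t _ _ (is_derive1_atan _) h1.
apply: (is_derive_eq h2).
rewrite (_ : (_ * _) t = complex.Im (f t) * (complex.Re (f t))^-1) //.
rewrite !(complexReM, complexImM, complexReV, complexImV) /GRing.scale /=.
move: n1 r1; rewrite /normsq; move: (complex.Re (f t)) (complex.Im (f t)) => x y n1 r1.
field.
by rewrite r1 n1.
Qed.

Variable b : C.
Hypothesis b1 : normsq b < 1.
Local Notation v := (pole b).
Local Notation e := (@ucircle R).

Lemma normsqM (x y : C) : normsq (x * y) = normsq x * normsq y.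
Proof. by rewrite /normsq complexReM complexImM; ring. Qed.

Lemma Re_one_sub_gt0 (z : C) : normsq z <= 1 -> 0 < complex.Re (1 - b * z).
Proof.
move=> z1.
have h : normsq (b * z) < 1.
  by rewrite normsqM (le_lt_trans _ b1) // ler_piMr ?normsq_ge0.
rewrite complexReD complexReN /= subr_gt0.
move: h; rewrite /normsq; move: (complex.Re (b * z)) (complex.Im (b * z)) => x y h.
by nra.
Qed.

Lemma one_sub_neq0 (z : C) : normsq z <= 1 -> 1 - b * z != 0.
Proof. by move=> /Re_one_sub_gt0; case: eqP => // ->; rewrite ltxx. Qed.

Lemma one_sub_ucircle_neq0 t : 1 - b * e t != 0.
Proof. by apply: one_sub_neq0; rewrite normsq_ucircle. Qed.

(** The only mean that needs a transcendental primitive: i log (1 - b z) is a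
    primitive of v - 1 along the circle, and 1 - b z stays in the right
    half-plane because |b| < 1. *)
Lemma circle_mean_pole : circle_mean (v \o e) 1.
Proof.
pose L s := (ln (normsq (1 - b * e s)) / 2) +i*
            atan (complex.Im (1 - b * e s) / complex.Re (1 - b * e s)).
exists (fun s => 'i * L s) => [|t]; first by rewrite /L ucircle_2pi.
have hu := curve_derivB (curve_deriv_cst 1 t) (curve_derivZ b (curve_deriv_ucircle t)).
have hr : 0 < complex.Re (1 - b * e t) by apply: Re_one_sub_gt0; rewrite normsq_ucircle.
apply: (curve_deriv_eq (curve_derivZ 'i (curve_deriv_log hr hu))).
have := one_sub_ucircle_neq0 t; rewrite /= /pole => n0.
have -> : 'i * ((0 - b * ('i * e t)) / (1 - b * e t)) =
   - ('i ^+ 2) * (b * e t) / (1 - b * e t) by ring.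
by rewrite sqr_i; field.
Qed.

(** z d/dz maps v^n to n (v^(n+1) - v^n), so all positive powers of v have the
    mean of v. *)
Lemma circle_mean_poleX n : circle_mean (fun t => v (e t) ^+ n) 1.
Proof.
elim: n => [|[|n] IH].
- by apply: circle_mean_ext (circle_mean_cst 1) => t; rewrite expr0.
- exact: circle_mean_pole.
have n0 : n.+1%:R != 0 :> C by rewrite pnatr_eq0.
have h : circle_mean (fun t => n.+1%:R * (v (e t) ^+ n.+2 - v (e t) ^+ n.+1)) 0.
  apply: (circle_mean_deriv (P := fun t => v (e t) ^+ n.+1)) => [|t].
    by rewrite ucircle_2pi.
  have := curve_deriv_mono (curve_deriv_ucircle t) (one_sub_ucircle_neq0 t) 0 n.+1.
  move=> /(curve_deriv_ext (g := fun s => v (e s) ^+ n.+1)) h.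
  apply: curve_deriv_eq (h _) _ => [s|]; first by rewrite mul1r.
  by rewrite mul0r add0r !mul1r.
apply: (circle_mean_eq (circle_mean_ext _ (circle_meanD IH (circle_meanZ n.+1%:R^-1 h)))).
  by move=> t; rewrite mulrA mulVf // mul1r addrC subrK.
by rewrite mulr0 addr0.
Qed.

(** The mean value property for z^a v^n.  When b is not zero, the relation
    b z v = v - 1 lowers the exponent of z; when b = 0, v is constant. *)
Lemma circle_mean_mono a n :
  circle_mean (fun t => e t ^+ a * v (e t) ^+ n) (a == 0)%:R.
Proof.
have base m : circle_mean (fun t => e t ^+ m.+1) 0.
  have m0 : m.+1%:R != 0 :> C by rewrite pnatr_eq0.
  have h : circle_mean (fun t => m.+1%:R * e t ^+ m.+1) 0.
    apply: (circle_mean_deriv (P := fun t => e t ^+ m.+1)) => [|t].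
      by rewrite ucircle_2pi.
    apply: (curve_deriv_eq (curve_derivX m.+1 (curve_deriv_ucircle t))).
    by rewrite /= [in RHS]exprS; ring.
  apply: (circle_mean_eq (circle_mean_ext _ (circle_meanZ m.+1%:R^-1 h))).
    by move=> t; rewrite mulrA mulVf // mul1r.
  by rewrite mulr0.
elim: a n => [|a IH] n.
  by apply: circle_mean_ext (circle_mean_poleX n) => t; rewrite mul1r.
have [b0|b0] := eqVneq b 0.
  apply: circle_mean_ext (base a) => t.
  by rewrite /pole b0 mul0r subr0 invr1 expr1n mulr1.
case: n => [|n].
  by apply: circle_mean_ext (base a) => t; rewrite expr0 mulr1.
apply: (circle_mean_eq (circle_mean_ext _ (circle_meanZ b^-1
  (circle_meanD (IH n.+1) (circle_meanZ (-1) (IH n)))))).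
  move=> t; have := one_sub_ucircle_neq0 t => n0.
  rewrite /pole !exprS; set w := (1 - _)^-1 ^+ n; field.
  by rewrite n0 b0.
by rewrite mulN1r subrr mulr0.
Qed.

Local Notation D := (1 - normsq b).

(** The mean of conj v times f is the pairing of f with the Szego kernel at
    conj b, which gives f (conj b) for f analytic near the closed disk.  The first
    condition concerns the other pairing that occurs: conj F has the two parts
    conj z and conj (z^2 v), and conj z paired with z^2 f is the mean of z f. *)
Definition reproduced (f : C -> C) : Prop :=
  circle_mean (fun t => e t * f (e t)) 0 /\
  circle_mean (fun t => (v (e t))^*%C * f (e t)) (f b^*%C).

Lemma reproduced_ext (f h : C -> C) : f =1 h -> reproduced f -> reproduced h.
Proof. by move=> /funext <-. Qed.

Lemma reproducedD (f h : C -> C) : reproduced f -> reproduced h ->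
  reproduced (fun z => f z + h z).
Proof.
move=> [f1 f2] [h1 h2]; split.
  apply: (circle_mean_eq (circle_mean_ext _ (circle_meanD f1 h1)));
    last by rewrite addr0.
  by move=> t; rewrite mulrDr.
by apply: circle_mean_ext (circle_meanD f2 h2) => t; rewrite mulrDr.
Qed.

Lemma reproducedZ c (f : C -> C) : reproduced f -> reproduced (fun z => c * f z).
Proof.
move=> [f1 f2]; split.
  apply: (circle_mean_eq (circle_mean_ext _ (circle_meanZ c f1)));
    last by rewrite mulr0.
  by move=> t; rewrite mulrCA.
by apply: circle_mean_ext (circle_meanZ c f2) => t; rewrite mulrCA.
Qed.

Lemma pole_conj : v b^*%C = (D%:C)^-1.
Proof. by rewrite /pole -normsqE rmorphB. Qed.

Lemma conj_one_sub_ucircle_neq0 t : 1 - b^*%C * (e t)^*%C != 0.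
Proof.
by rewrite -rmorphM -[X in X - _](rmorph1 (conjc)) -rmorphB fmorph_eq0 one_sub_ucircle_neq0.
Qed.

Lemma conj_pole_ucircle t : (v (e t))^*%C = (1 - b^*%C * (e t)^*%C)^-1.
Proof. by rewrite /pole fmorphV rmorphB rmorph1 rmorphM. Qed.

(** The partial fraction decomposition of the Poisson kernel of b. *)
Lemma pole_mul_conj t :
  D%:C * ((v (e t))^*%C * v (e t)) = v (e t) + (v (e t))^*%C - 1.
Proof.
have n0 := one_sub_ucircle_neq0 t; have n1 := conj_one_sub_ucircle_neq0 t.
rewrite conj_pole_ucircle /pole.
have -> : D%:C = (1 - b * e t) + (1 - b^*%C * (e t)^*%C)
   - (1 - b * e t) * (1 - b^*%C * (e t)^*%C) :> C.
  transitivity (1 - b * b^*%C * (e t * (e t)^*%C)); last by ring.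
  by rewrite ucircleK mulr1 -normsqE rmorphB.
by field; rewrite n0 n1.
Qed.

Lemma mul_conj_pole t : e t * (v (e t))^*%C = e t + b^*%C * (v (e t))^*%C.
Proof.
have n1 := conj_one_sub_ucircle_neq0 t.
have h : (v (e t))^*%C = 1 + b^*%C * (e t)^*%C * (v (e t))^*%C.
  by rewrite conj_pole_ucircle; field.
rewrite {1}h mulrDr mulr1; congr (_ + _).
transitivity (e t * (e t)^*%C * (b^*%C * (v (e t))^*%C)); first by ring.
by rewrite ucircleK mul1r.
Qed.

(** Induction on the exponents: on the circle D |v|^2 = v + conj v - 1 lowers the
    power of v and contributes a factor 1/D = v (conj b), and
    z conj v = z + conj b conj v lowers the power of z and contributes a factor
    conj b. *)
Lemma reproduced_mono a n : reproduced (fun z => z ^+ a * v z ^+ n).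
Proof.
split.
  by apply: circle_mean_ext (circle_mean_mono a.+1 n) => t; rewrite exprS mulrA.
elim: a n => [|a IH].
  elim=> [|n IH].
    apply: (circle_mean_eq (circle_mean_ext _ (circle_mean_conj circle_mean_pole))).
      by move=> t; rewrite !expr0 !mulr1.
    by rewrite !expr0 mulr1 rmorph1.
  have D0 : D%:C != 0
    by rewrite -(rmorph0 (real_complex R)) (inj_eq (@complexI R)) subr_eq0 gt_eqF.
  apply: (circle_mean_eq (circle_mean_ext _ (circle_meanZ (D%:C)^-1
    (circle_meanD IH (circle_meanD (circle_mean_mono 0 n.+1)
      (circle_meanZ (-1) (circle_mean_mono 0 n))))))).
    move=> t; rewrite !expr0 !mul1r exprS.
    apply: (mulfI D0); rewrite mulVKf //.
    rewrite [X in _ = _ * X]mulrA [RHS]mulrA pole_mul_conj; ring.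
  rewrite mulN1r subrr addr0 !expr0 !mul1r exprS pole_conj //.
move=> n.
apply: (circle_mean_eq (circle_mean_ext _ (circle_meanD (circle_mean_mono a.+1 n)
  (circle_meanZ b^*%C (IH n))))).
  move=> t; rewrite exprS.
  transitivity (e t ^+ a * v (e t) ^+ n * (e t + b^*%C * (v (e t))^*%C)); first by ring.
  by rewrite -mul_conj_pole; ring.
by rewrite add0r exprS mulrA.
Qed.
End CircleMeansOfPoles.

(** * The mean of the integrand *)

Section MeanOfIntegrand.
Variable R : realType.
Local Notation C := R[i].
Variables b g k : C.
Hypothesis b1 : normsq b < 1.
Local Notation v := (pole b).
Local Notation e := (@ucircle R).
Local Notation F := (Ffrac b g k).
Local Notation G := (Gfrac b g k).
Local Notation K := (Kfrac b g k).
Local Notation L := (Lfrac b g k).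

Lemma conj_Ffrac z :
  (F z)^*%C = g^*%C * z^*%C + k^*%C * z^*%C ^+ 2 * (v z)^*%C.
Proof. by rewrite /Ffrac expr2 !(rmorphD, rmorphM) -expr2. Qed.

(** The quotient of (B - g z) by z^2, where B = (1 - F) L - 2 G K is the function
    obtained by integrating by parts. *)
Definition Btail (z : C) : C :=
  k * (v z + v z ^+ 2 + 6 * v z ^+ 4) - 3 * g ^+ 2
  - g * k * z * (6 * v z + 5 * v z ^+ 2 + 4 * v z ^+ 3 + 6 * v z ^+ 4)
  - k ^+ 2 * z ^+ 2 * (3 * v z ^+ 2 + 5 * v z ^+ 3 + 6 * v z ^+ 4 + 10 * v z ^+ 5).

Lemma BtailE z : (1 - F z) * L z - 2 * G z * K z = g * z + z ^+ 2 * Btail z.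
Proof. by rewrite /Ffrac /Lfrac /Gfrac /Kfrac /Btail; ring. Qed.

Lemma reproduced_Btail : reproduced b Btail.
Proof.
have m c a n := reproducedZ c (reproduced_mono b1 a n).
apply: reproduced_ext
  (reproducedD (reproducedD (m k 0 1) (reproducedD (m k 0 2) (m (6 * k) 0 4)))
  (reproducedD (m (- 3 * g ^+ 2) 0 0)
  (reproducedD (reproducedD (m (- 6 * g * k) 1 1) (reproducedD (m (- 5 * g * k) 1 2)
    (reproducedD (m (- 4 * g * k) 1 3) (m (- 6 * g * k) 1 4))))
  (reproducedD (m (- 3 * k ^+ 2) 2 2) (reproducedD (m (- 5 * k ^+ 2) 2 3)
    (reproducedD (m (- 6 * k ^+ 2) 2 4) (m (- 10 * k ^+ 2) 2 5))))))) => z.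
by rewrite /Btail; ring.
Qed.

(** Expanding conj F = conj g conj z + conj k conj(z^2 v) against
    B = g z + z^2 C and using |z| = 1 leaves |g|^2, the mean-zero terms z C and
    conj (z v), and conj k conj v C, whose mean is reproduced at conj b. *)
Lemma circle_mean_conjF_mul :
  circle_mean (fun t => (F (e t))^*%C *
    ((1 - F (e t)) * L (e t) - 2 * G (e t) * K (e t)))
    (g * g^*%C + k^*%C * Btail b^*%C).
Proof.
have [h1 h2] := reproduced_Btail.
have h3 : circle_mean (fun t => (e t * v (e t))^*%C) 0.
  rewrite -(rmorph0 (conjc)).
  apply: circle_mean_conj; apply: circle_mean_ext (circle_mean_mono b1 1 1) => t.
  by [].
apply: (circle_mean_eq (circle_mean_ext _ (circle_meanD
   (circle_meanD (circle_mean_cst (g * g^*%C)) (circle_meanZ g^*%C h1))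
   (circle_meanD (circle_meanZ (k^*%C * g) h3) (circle_meanZ k^*%C h2))))); last first.
  by rewrite !mulr0 addr0 add0r.
move=> t; rewrite BtailE conj_Ffrac.
set x := e t; set y := x^*%C.
have xy : x * y = 1 by exact: ucircleK.
have xy2 : x ^+ 2 * y ^+ 2 = 1 by rewrite -exprMn xy expr1n.
have xy3 : x * y ^+ 2 = y by rewrite expr2 mulrA xy mul1r.
have xy4 : x ^+ 2 * y = x by rewrite expr2 -mulrA xy mulr1.
set c := Btail x; set V := (v x)^*%C.
transitivity (g * g^*%C * (x * y) + g^*%C * c * (x ^+ 2 * y) +
  k^*%C * g * V * (x * y ^+ 2) + k^*%C * V * c * (x ^+ 2 * y ^+ 2)); last by ring.
by rewrite xy xy2 xy3 xy4; ring.
Qed.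

Definition integrand (t : R) : R :=
  (1 - complex.Re (F (e t))) * complex.Re ((G (e t))^*%C * K (e t)).

Lemma complexRe_half_conj (x : C) : (complex.Re x)%:C = 2^-1 * (x + x^*%C).
Proof.
have h : (2 : C) != 0 by rewrite pnatr_eq0.
apply: (mulfI h); rewrite mulrA mulfV // mul1r.
by apply: complex_eq; rewrite ?(complexReM, complexImM, complexReD, complexImD);
  case: x => p q /=; ring.
Qed.

Lemma circle_mean_Re (f : R -> C) m : circle_mean f m ->
  circle_mean (fun t => (complex.Re (f t))%:C) (complex.Re m)%:C.
Proof.
move=> h; apply: (circle_mean_eq (circle_mean_ext _ (circle_meanZ 2^-1
  (circle_meanD h (circle_mean_conj h))))); last by rewrite -complexRe_half_conj.
by move=> t; rewrite -complexRe_half_conj.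
Qed.

(** Integration by parts moves the Euler derivatives off the conjugated factors:
    the integrand and Re (conj F B) differ by the Euler derivative of [W]. *)
Lemma circle_mean_integrand :
  circle_mean (fun t => (integrand t)%:C)
    (complex.Re (g * g^*%C + k^*%C * Btail b^*%C))%:C.
Proof.
pose F' t := F (e t). pose G' t := G (e t). pose K' t := K (e t). pose L' t := L (e t).
(* Along the circle the Euler operator anticommutes with conjugation, so a
   real Euler derivative comes from a sum of products each taken minus its
   conjugate. *)
pose W t := 4^-1 * (2 * (F' t * (K' t)^*%C - (F' t)^*%C * K' t)
  + 2 * (F' t * (F' t)^*%C * (K' t - (K' t)^*%C))
  + (F' t - (F' t)^*%C) * (G' t * (G' t)^*%C)
  + ((F' t)^*%C * G' t ^+ 2 - F' t * (G' t)^*%C ^+ 2)).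
have dF t := curve_deriv_F g k (curve_deriv_ucircle t) (one_sub_ucircle_neq0 b1 t).
have dG t := curve_deriv_G g k (curve_deriv_ucircle t) (one_sub_ucircle_neq0 b1 t).
have dK t := curve_deriv_K g k (curve_deriv_ucircle t) (one_sub_ucircle_neq0 b1 t).
rewrite -[X in circle_mean _ X]addr0.
have hW : circle_mean (fun t => (integrand t)%:C - (complex.Re
   ((F' t)^*%C * ((1 - F' t) * L' t - 2 * G' t * K' t)))%:C) 0.
  apply: (circle_mean_deriv (P := W)) => [|t].
    by rewrite /W /F' /G' /K' ucircle_2pi.
  have cF := curve_deriv_conj (dF t).
  have cG := curve_deriv_conj (dG t).
  have cK := curve_deriv_conj (dK t).
  have T1 := curve_derivZ 2 (curve_derivB (curve_derivM (dF t) cK)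
    (curve_derivM cF (dK t))).
  have T2 := curve_derivZ 2 (curve_derivM (curve_derivM (dF t) cF)
    (curve_derivB (dK t) cK)).
  have T3 := curve_derivM (curve_derivB (dF t) cF) (curve_derivM (dG t) cG).
  have T4 := curve_derivB (curve_derivM cF (curve_derivX 2 (dG t)))
    (curve_derivM (dF t) (curve_derivX 2 cG)).
  apply: (curve_deriv_eq (curve_derivZ 4^-1
    (curve_derivD (curve_derivD (curve_derivD T1 T2) T3) T4))).
  have -> : (integrand t)%:C = (1 - (complex.Re (F (e t)))%:C) *
      (complex.Re ((G (e t))^*%C * K (e t)))%:C :> C.
    by rewrite /integrand; apply: complex_eq; rewrite ?complexReM ?complexImM /=; ring.
  rewrite !complexRe_half_conj /F' /G' /K' /L' /=.
  move: (F (e t)) (G (e t)) (K (e t)) (L (e t)) => p q r s.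
  have ci x : ('i * x)^*%C = - 'i * x^*%C :> C.
    by rewrite rmorphM; congr (_ * _); apply: complex_eq; rewrite /= ?oppr0.
  have cK' (x : C) : x^*%C^*%C = x by case: x => x1 x2; rewrite /= opprK.
  have -> : ((q^*%C * r)^*%C = q * r^*%C :> C) by rewrite rmorphM /= cK'.
  have -> : ((p^*%C * ((1 - p) * s - 2 * q * r))^*%C
      = p * ((1 - p^*%C) * s^*%C - 2 * q^*%C * r^*%C) :> C).
    by rewrite !(rmorphM, rmorphB, rmorph1, rmorph_nat) /= cK'.
  rewrite !ci ?expr1.
  move: p^*%C q^*%C r^*%C s^*%C => p' q' r' s'.
  by field.
apply: (circle_mean_ext _ (circle_meanD (circle_mean_Re circle_mean_conjF_mul) hW)) => t.
by rewrite addrC subrK.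
Qed.
End MeanOfIntegrand.

(** * The value of the mean and its positivity *)

Section MeanValue.
Variable K : fieldType.
Implicit Types (X Y D mu : K).

(** The value of the mean as an affine function of X and Y.  It is defined over any
    field so that it can be computed over the complex numbers, in terms of b and
    its conjugate, and estimated over the reals. *)
Definition mean_cst D mu : K :=
  1 + 2 * mu * D - 3 * mu * D ^+ 2
  + mu ^+ 2 * (- D^-1 - 2 - 5 / 2 * D + 6 * D ^+ 2)
  + mu ^+ 3 * (10 / D ^+ 2 + 3 / D + 3 + D / 2 - 3 * D ^+ 2).

Definition mean_X D mu : K :=
  - (mu * (1 - mu) + 3 / 2 * mu * D * (1 - mu) ^+ 2
     + mu ^+ 3 * (2 / D ^+ 2 + D^-1)).

Definition mean_Y D mu : K :=
  - (3 / 2 * mu * D * (1 - mu) ^+ 2) + 5 / 2 * mu ^+ 2 * (1 - mu)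
  + mu ^+ 2 * (3 - 5 * mu) / D ^+ 2 + mu ^+ 2 * (2 - 3 * mu) / D.

Definition mean_value X Y D mu : K :=
  mean_cst D mu + mean_X D mu * X + mean_Y D mu * Y.

End MeanValue.

Section Positivity.
Variable R : realFieldType.
Implicit Types (X Y D mu : R).

(** Both [mean_X] and [mean_X - mean_Y] are nonpositive, which allows X to be
    raised to its bound 4 - 2 D - Y and then Y to be lowered to 0.  The resulting
    function of D and mu differs from its value at D = 1 by (1 - D) mu times a
    quadratic polynomial in mu and r = mu / D, nonnegative where 0 < mu <= r. *)
Lemma mean_value_gt0 X Y D mu : 0 < D -> D <= 1 -> 0 < mu -> mu < 1 ->
  0 <= Y -> X + Y + 2 * D <= 4 -> 0 < mean_value X Y D mu.
Proof.
move=> D0 D1 m0 m1 Y0 XY.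
have D0' : D != 0 by rewrite gt_eqF.
pose r := mu / D.
have mr : mu <= r by rewrite /r ler_pdivlMr // ler_piMr // ltW.
have r0 : 0 < r by exact: lt_le_trans mr.
have hX : mean_X D mu <= 0.
  rewrite /mean_X oppr_le0.
  have -> : mu ^+ 3 * (2 / D ^+ 2 + D^-1) = 2 * mu * r ^+ 2 + mu ^+ 2 * r
    by rewrite /r; field.
  have : 0 <= mu * (1 - mu) by rewrite mulr_ge0 ?subr_ge0 ?ltW.
  have : 0 <= mu * D * (1 - mu) ^+ 2 by rewrite mulr_ge0 ?sqr_ge0 // mulr_ge0 // ltW.
  have : 0 <= mu * r ^+ 2 by rewrite mulr_ge0 ?sqr_ge0 // ltW.
  have : 0 <= mu ^+ 2 * r by rewrite mulr_ge0 ?sqr_ge0 // ltW.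
  lra.
have hXY : mean_X D mu <= mean_Y D mu.
  rewrite -subr_ge0.
  have -> : mean_Y D mu - mean_X D mu =
      (1 - mu) * (mu + 5 / 2 * mu ^+ 2 + 3 * r ^+ 2 + 2 * mu * r).
    by rewrite /mean_X /mean_Y /r; field.
  have := mulr_gt0 m0 r0; have := sqr_ge0 mu; have := sqr_ge0 r.
  by move=> *; apply: mulr_ge0; lra.
have -> : mean_value X Y D mu = (mean_cst D mu + mean_X D mu * (4 - 2 * D))
   + - mean_X D mu * (4 - 2 * D - X - Y) + (mean_Y D mu - mean_X D mu) * Y.
  by rewrite /mean_value; ring.
apply: ltr_wpDr; first by rewrite mulr_ge0 // subr_ge0.
apply: ltr_wpDr; first by rewrite mulr_ge0 ?oppr_ge0 //; lra.
have -> : mean_cst D mu + mean_X D mu * (4 - 2 * D) =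
  (1 - 6 * mu + 17 / 2 * mu ^+ 2 + 9 / 2 * mu ^+ 3)
  + (1 - D) * mu * (2 - r - 15 / 2 * mu + 2 * r ^+ 2 + 5 * r * mu + 11 / 2 * mu ^+ 2).
  by rewrite /mean_cst /mean_X /r; field.
apply: ltr_wpDr.
  rewrite mulr_ge0 //; first by rewrite mulr_ge0 // ?subr_ge0 // ltW.
  have -> : 2 - r - 15 / 2 * mu + 2 * r ^+ 2 + 5 * r * mu + 11 / 2 * mu ^+ 2
    = 25 / 2 * mu ^+ 2 - 17 / 2 * mu + 2 + (r - mu) * (9 * mu - 1) + 2 * (r - mu) ^+ 2
      by field.
  (* The cross term changes sign at mu = 1/9: below, the square in r - mu is
     completed; above, all three parts are nonnegative. *)
  have [m9|m9] := lerP (9 * mu) 1.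
    have := sqr_ge0 (r - mu + (9 * mu - 1) / 4).
    have : 0 <= mu * (1 - 9 * mu) by rewrite mulr_ge0 ?subr_ge0 // ltW.
    by have := sqr_ge0 mu; lra.
  have : 0 <= (r - mu) * (9 * mu - 1) by rewrite mulr_ge0 // subr_ge0 // ltW.
  have := sqr_ge0 (r - mu); have := sqr_ge0 (mu - 17 / 50); lra.
(* The polynomial is (1 - 3 mu)^2 + mu^2 (9 mu - 1) / 2, and the last term is negative
   only for mu < 1/9, where the square is at least 4/9. *)
have [m9|m9] := lerP (9 * mu) 1.
  have : 0 < mu ^+ 3 by rewrite exprn_gt0.
  by have := sqr_ge0 mu; lra.
have : 0 < mu ^+ 2 * (9 * mu - 1) by rewrite mulr_gt0 ?exprn_gt0 // subr_gt0.
by have := sqr_ge0 (1 - 3 * mu); lra.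
Qed.
End Positivity.

Section Value.
Variable R : realType.
Local Notation C := R[i].

Lemma mean_value_rmorph (X Y D mu : R) :
  (mean_value X Y D mu)%:C = mean_value X%:C Y%:C D%:C mu%:C :> C.
Proof.
by rewrite /mean_value /mean_cst /mean_X /mean_Y
  !(rmorphD, rmorphN, rmorphM, rmorphXn, fmorphV, rmorph1, rmorph_nat).
Qed.

Lemma conj_Btail (b g k z : C) :
  (Btail b g k z)^*%C = Btail b^*%C g^*%C k^*%C z^*%C.
Proof.
have hp : (pole b z)^*%C = pole b^*%C z^*%C.
  by rewrite /pole fmorphV rmorphB rmorph1 rmorphM.
by rewrite /Btail -hp; move: (pole b z) => p; ring.
Qed.

(** A rational identity in b, conj b and l once the real part is written as half the
    sum with the conjugate; note that 1 - b conj b = D and v (conj b) = 1/D. *)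
Lemma Re_mean_eq_mean_value (b : C) (l : R) : normsq b < 1 -> b != 1 ->
  let d := 1 - b in let g := 1 - l%:C * d in let k := l%:C * d ^+ 2 in
  complex.Re (g * g^*%C + k^*%C * Btail b g k b^*%C) =
  mean_value ((1 - normsq b) ^+ 2 / normsq d) (normsq d) (1 - normsq b)
    (l * normsq d / (1 - normsq b)).
Proof.
move=> b1 bn1 d g k.
have cK (x : C) : x^*%C^*%C = x by case: x => x1 x2; rewrite /= opprK.
have lc : (l%:C)^*%C = l%:C :> C by rewrite /= oppr0.
pose B := b^*%C.
have gc : g^*%C = 1 - l%:C * (1 - B) by rewrite -[in RHS]lc /g /d /B; ring.
have kc : k^*%C = l%:C * (1 - B) ^+ 2. by rewrite -[in RHS]lc /k /d /B; ring.
have hD : (1 - normsq b)%:C = 1 - b * B :> C by rewrite /B -normsqE rmorphB.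
have he : (normsq d)%:C = (1 - b) * (1 - B) :> C.
  by rewrite normsqE /d /B; ring.
have D0 : 1 - b * B != 0.
  by rewrite -hD -(rmorph0 (real_complex R)) (inj_eq (@complexI R)) subr_eq0 gt_eqF.
have d0 : 1 - b != 0 by rewrite subr_eq0 eq_sym.
have d1 : 1 - B != 0 by rewrite -(rmorph1 conjc) -rmorphB fmorph_eq0.
apply: (@complexI R); rewrite mean_value_rmorph complexRe_half_conj.
have -> : (g * g^*%C + k^*%C * Btail b g k b^*%C)^*%C =
  g^*%C * g + k * Btail B g^*%C k^*%C b.
  have <- : (Btail b g k B)^*%C = Btail B g^*%C k^*%C b.
    by rewrite conj_Btail /B cK.
  move: (Btail b g k b^*%C) => y;
    rewrite -[X in _ = _ * X + _](cK g) -[X in _ = _ + X * _](cK k); ring.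
have -> : ((1 - normsq b) ^+ 2 / normsq d)%:C = (1 - b * B) ^+ 2 / ((1 - b) * (1 - B)) :> C.
  by rewrite -hD -he rmorphM rmorphXn fmorphV.
have -> : (l * normsq d / (1 - normsq b))%:C = l%:C * ((1 - b) * (1 - B)) / (1 - b * B) :> C.
  by rewrite -hD -he !rmorphM fmorphV.
rewrite hD he gc kc /k /g /d -/B.
rewrite /mean_value /mean_cst /mean_X /mean_Y /Btail /pole.
rewrite [B * b]mulrC; move: (l%:C : C) D0 d0 d1 => L;
  move: b B {b1 bn1 d g k lc gc kc hD he} => b B.
move=> D0 d0 d1; field.
by rewrite D0 d0 d1.
Qed.
End Value.

(** * Complex differentiability of the rational function *)

Section ComplexAnalytic.
Variable R : realType.
Local Notation C := R[i].

(** The product and sum rules in pointwise form: with the domain and the codomain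
    fixed to the complex field they can be chained without searching for the
    normed-module structures. *)
Lemma complex_is_deriveM (f h : C -> C) (z df dh : C) :
  is_derive z (1 : C) f df -> is_derive z (1 : C) h dh ->
  is_derive z (1 : C) (fun u => f u * h u) (f z * dh + h z * df).
Proof. by move=> hf hh; exact: is_deriveM. Qed.

Lemma complex_is_deriveD (f h : C -> C) (z df dh : C) :
  is_derive z (1 : C) f df -> is_derive z (1 : C) h dh ->
  is_derive z (1 : C) (fun u => f u + h u) (df + dh).
Proof. by move=> hf hh; exact: is_deriveD. Qed.

Lemma complex_is_deriveZ (f : C -> C) (c z df : C) : is_derive z (1 : C) f df ->
  is_derive z (1 : C) (fun u => c * f u) (c * df).
Proof.
move=> hf; have hc : is_derive z (1 : C) (fun=> c) 0 by exact: is_derive_cst.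
by apply: is_derive_eq (complex_is_deriveM hc hf) _; rewrite mulr0 addr0.
Qed.

Lemma complex_is_deriveV (f : C -> C) (z df : C) : f z != 0 ->
  is_derive z (1 : C) f df ->
  is_derive z (1 : C) (fun u => (f u)^-1) (- df / f z ^+ 2).
Proof.
move=> f0 [hf1 hf2]; split; first exact: derivableV.
rewrite (deriveV f0 hf1) hf2 /GRing.scale /=; ring.
Qed.

Lemma is_derive_one_sub (b z : C) : is_derive z (1 : C) (fun u => 1 - b * u) (- b).
Proof.
have hid : is_derive z (1 : C) (fun u : C => u) 1 by exact: is_derive_id.
have h1 : is_derive z (1 : C) (fun=> 1 : C) 0 by exact: is_derive_cst.
rewrite (_ : (fun u => 1 - b * u) = (fun u => 1 + - b * u)); last first.
  by apply/funext => u; rewrite mulNr.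
by apply: is_derive_eq (complex_is_deriveD h1 (complex_is_deriveZ (- b) hid)) _; ring.
Qed.

Variables (b g k : C).

Lemma is_derive_Ffrac (z : C) : 1 - b * z != 0 ->
  is_derive z (1 : C) (Ffrac b g k)
    (g + k * (2 * z * pole b z + b * z ^+ 2 * pole b z ^+ 2)).
Proof.
move=> z0.
have hid : is_derive z (1 : C) (fun u : C => u) 1 by exact: is_derive_id.
have hv := @complex_is_deriveV (fun u => 1 - b * u) z _ z0 (is_derive_one_sub b z).
have hk := complex_is_deriveZ k (complex_is_deriveM hid hid).
apply: is_derive_eq (complex_is_deriveD (complex_is_deriveZ g hid)
  (complex_is_deriveM hk hv)) _.
by rewrite /pole; field.
Qed.

Lemma Ffrac_continuous (z : C) : 1 - b * z != 0 -> {for z, continuous (Ffrac b g k)}.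
Proof.
move=> z0; apply: differentiable_continuous; apply/derivable1_diffP.
by have [] := is_derive_Ffrac z0.
Qed.

Lemma open_one_sub_neq0 : open [set z : C | 1 - b * z != 0].
Proof.
have h : continuous (fun z : C => 1 - b * z).
  move=> z; apply: differentiable_continuous; apply/derivable1_diffP.
  by have [] := is_derive_one_sub b z.
rewrite (_ : [set z | _] = (fun z : C => 1 - b * z) @^-1` [set x | x != 0]) //.
apply: open_comp => [z _|]; first exact: h.
rewrite (_ : [set x | _] = ~` [set (0 : C)]).
  by rewrite openC; apply: accessible_closed_set1;
    apply: hausdorff_accessible; exact: norm_hausdorff.
by apply/seteqP; split => x /= /eqP.
Qed.

Lemma near_one_sub_neq0 (z : C) : 1 - b * z != 0 -> \forall u \near z, 1 - b * u != 0.
Proof. by move=> z0; exact: (open_nbhs_nbhs (conj open_one_sub_neq0 z0)). Qed.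

(** Stated for any function that agrees with [Ffrac] off the pole, since the
    limit defining F is only known to agree with the rational function there. *)
Lemma zderiv_Ffrac (f : C -> C) (z : C) : 1 - b * z != 0 ->
  (forall u, 1 - b * u != 0 -> f u = Ffrac b g k u) ->
  zderiv f z = Gfrac b g k z.
Proof.
move=> z0 hf; rewrite /zderiv derive1E (near_eq_derive (g := Ffrac b g k)); last first.
  by near=> u; apply: hf; near: u; exact: near_one_sub_neq0.
have [_ ->] := is_derive_Ffrac z0.
by rewrite /Gfrac /pole; field.
Unshelve. all: by end_near. Qed.

End ComplexAnalytic.

Section Punctured.
Variable R : realType.
Local Notation C := R[i].

(** A nonzero affine function has at most one zero, so it does not vanish near any
    point once that point is removed; hence the limit defining F sees neither 1
    nor 1 / alpha. *)
Lemma near_punctured_one_sub_neq0 (b z : C) : \forall u \near z^', 1 - b * u != 0.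
Proof.
have [->|b0] := eqVneq b 0.
  by near=> u; rewrite mul0r subr0 oner_neq0.
have [z0|z0] := eqVneq (1 - b * z) 0;
  last by apply: cvg_within; exact: near_one_sub_neq0.
near=> u; have uz : u != z by near: u; exact: nbhs_dnbhs_neq.
apply: contra uz => /eqP u0; apply/eqP/(mulfI b0).
by move/eqP: z0; rewrite subr_eq0 => /eqP <-; move/eqP: u0; rewrite subr_eq0 => /eqP.
Unshelve. all: by end_near. Qed.

End Punctured.

(** * Evaluation of the functional *)

Section Moduli.
Variable R : realType.
Local Notation C := R[i].
Implicit Types x : C.

Lemma complex_normE x : `|x| = (Num.sqrt (normsq x))%:C.
Proof. by case: x. Qed.

Lemma complex_norm_lt1 x : (`|x| < 1) = (normsq x < 1).
Proof. by rewrite complex_normE ltcR -[X in _ < X]sqrtr1 ltr_sqrt. Qed.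

Lemma complex_norm_le1 x : (`|x| <= 1) = (normsq x <= 1).
Proof. by rewrite complex_normE lecR -[X in _ <= X]sqrtr1 ler_sqrt. Qed.

Lemma modulus_sqr x : modulus x ^+ 2 = normsq x.
Proof. by rewrite /modulus complex_normE /= sqr_sqrtr // normsq_ge0. Qed.

End Moduli.

Section Integral.
Variable R : realType.
Local Notation C := R[i].

Lemma curve_deriv_continuous_Re (f : R -> C) (t : R) d :
  curve_deriv f t d -> {for t, continuous (fun s => complex.Re (f s))}.
Proof.
move=> [[h _] _]; apply: differentiable_continuous.
exact/derivable1_diffP.
Qed.

Lemma Rintegral_circle_mean (f : R -> R) (m : R) :
  continuous f -> circle_mean (fun t => (f t)%:C) m%:C ->
  (\int[@lebesgue_measure R]_(t in `[0, 2 * pi]) f t) = 2 * pi * m.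
Proof.
move=> cf [P P2 hP].
have pi2 : 0 < 2 * pi :> R by rewrite mulr_gt0 // pi_gt0.
pose Q t := complex.Re (P t) + m * t.
have hQ t : is_derive t (1 : R) Q (f t).
  have [h _] := hP t.
  have h2 := is_deriveD h (is_deriveM (is_derive_cst m t 1) (is_derive_id t 1)).
  by apply: is_derive_eq h2 _; rewrite /GRing.scale /=; ring.
have cQ : continuous Q.
  move=> t; apply: differentiable_continuous; apply/derivable1_diffP.
  by have [] := hQ t.
rewrite /Rintegral (continuous_FTC2 (F := Q) pi2).
- by rewrite /= /Q P2; ring.
- exact: continuous_subspaceT.
- split.
  + by move=> t _; have [] := hQ t.
  + by apply: cvg_at_right_filter; exact: cQ.
  + by apply: cvg_at_left_filter; exact: cQ.
- by move=> t _; rewrite derive1E; have [_ ->] := hQ t.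
Qed.

(** On a ray the Euler operator is the radial derivative at radius one, so the
    derivative of |G|^2 is 2 Re (conj G K), and the functional is the mean of
    [integrand]. *)
Lemma calR_Ffrac (b g k : C) (f : C -> C) : normsq b < 1 ->
  (forall z, 1 - b * z != 0 -> f z = Ffrac b g k z) ->
  calR f = complex.Re (g * g^*%C + k^*%C * Btail b g k b^*%C).
Proof.
move=> b1 hf; set m := complex.Re _.
have pi0 : pi != 0 :> R by rewrite gt_eqF // pi_gt0.
rewrite /calR /calR_at.
have -> : (fun t : R => (1 - complex.Re (f (polar 1 t))) *
     derive1 (fun s : R => modulus (zderiv f (polar s t)) ^+ 2) 1) =
   (fun t => 2 * integrand b g k t).
  apply/funext => t.
  have hp := one_sub_ucircle_neq0 b1 t.
  rewrite hf //.
  have hray := curve_deriv_ray t.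
  have hu := curve_derivB (curve_deriv_cst 1 1) (curve_derivZ b hray).
  have near1 : \forall s \near (1 : R), 1 - b * polar s t != 0.
    have hr : 0 < complex.Re (1 - b * polar 1 t).
      by apply: Re_one_sub_gt0 => //; rewrite normsq_ucircle.
    have hn : \forall s \near (1 : R), 0 < complex.Re (1 - b * polar s t).
      exact: (curve_deriv_continuous_Re hu (open_nbhs_nbhs (conj (@open_gt _ 0) hr))).
    near=> s; have : 0 < complex.Re (1 - b * polar s t) by near: s.
    by case: eqP => // ->; rewrite ltxx.
  rewrite derive1E (near_eq_derive (g := fun s => normsq (Gfrac b g k (polar s t)))); last first.
    near=> s; rewrite modulus_sqr (zderiv_Ffrac (b := b) (g := g) (k := k)) //.
    by near: s.
  have hG := is_derive_normsq (curve_deriv_G g k hray hp).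
  have [_ ->] := hG.
  rewrite mul1r /integrand /ucircle complexReM.
  by case: (Gfrac b g k _) (Kfrac b g k _) => [x1 x2] [y1 y2] /=; ring.
rewrite (@Rintegral_circle_mean _ (2 * m)).
- by move: (pi : R) pi0 => p p0; field.
- move=> t.
  have dF := curve_deriv_F g k (curve_deriv_ucircle t) (one_sub_ucircle_neq0 b1 t).
  have dG := curve_deriv_G g k (curve_deriv_ucircle t) (one_sub_ucircle_neq0 b1 t).
  have dK := curve_deriv_K g k (curve_deriv_ucircle t) (one_sub_ucircle_neq0 b1 t).
  have := curve_derivZ 2 (curve_derivM (curve_derivB (curve_deriv_cst 1 t)
     (curve_derivZ 2^-1 (curve_derivD dF (curve_deriv_conj dF))))
     (curve_derivM (curve_deriv_conj dG) dK)).
  move/curve_deriv_continuous_Re; congr (continuous_at _ _).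
  apply/funext => s.
  rewrite -complexRe_half_conj /integrand.
  rewrite !complexReM !complexReD !complexReN
    !complexImM !complexImD !complexImN /=; ring.
- have c2 : (2 : R)%:C = 2 :> C by exact: (rmorph_nat (real_complex R) 2).
  have h := circle_meanZ 2 (circle_mean_integrand g k b1).
  apply: (circle_mean_eq (circle_mean_ext _ h)).
    by move=> t; rewrite -c2 -rmorphM.
  by rewrite -c2 -rmorphM.
Unshelve. all: by end_near. Qed.

End Integral.

(** * The two-point family *)

(** The left-hand side is (2 Re (1 - c))^2. *)
Lemma sqr_defect_le (R : realType) (c : R[i]) :
  ((1 - normsq c) + normsq (1 - c)) ^+ 2 <= 4 * normsq (1 - c).
Proof.
case: c => x y; rewrite /normsq /=.
by have := sqr_ge0 y; lra.
Qed.

Lemma polar_at_left (R : realType) (t : R) :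
  polar r t @[r --> (1 : R)^'-] --> ucircle t.
Proof.
apply/cvgrPdist_lt => e e0.
have eE : e = (complex.Re e)%:C.
  by apply: complex_eq => //=; move: e0; rewrite ltcE /= => /andP[/eqP ->].
have e1 : 0 < complex.Re e by move: e0; rewrite eE ltcR.
near=> r.
have -> : ucircle t - polar r t = (1 - r)%:C * ucircle t.
  by apply: complex_eq; rewrite ?complexReM ?complexImM /=; ring.
rewrite eE complex_normE ltcR normsqM normsq_ucircle mulr1
  /normsq /= expr0n /= addr0 sqrtr_sqr.
near: r; apply: cvg_within.
by have := @cvgr_dist_lt _ _ _ _ _ id (1 : R) (@cvg_id _ (nbhs (1:R))); apply.
Unshelve. all: by end_near. Qed.

Section TwoPointFamily.
Variable R : realType.
Local Notation C := R[i].
Variables (alpha : C) (w : R).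
Hypothesis alpha1 : unit_disk alpha.
Hypotheses (w0 : 0 < w) (w1 : w < 1).

Let b : C := w%:C * alpha + (1 - w)%:C.
Let g : C := w%:C + (1 - w)%:C * alpha.
Let k : C := g * b - alpha.
Let l : R := (1 - w) / w.

Let wC1 : (1 - w)%:C = 1 - w%:C :> C.
Proof. by rewrite rmorphB. Qed.

Lemma normsq_alpha_lt1 : normsq alpha < 1.
Proof. by rewrite -complex_norm_lt1. Qed.

(** The defect of convexity of the squared modulus at b, a convex combination of
    alpha and 1.  It gives both |b| < 1 and mu < 1. *)
Lemma one_sub_normsq_b :
  1 - normsq b = w * (1 - normsq alpha) + w * (1 - w) * normsq (1 - alpha).
Proof. by rewrite /b; case: alpha => x y; rewrite /normsq /=; ring. Qed.

Lemma normsq_b_lt1 : normsq b < 1.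
Proof.
rewrite -subr_gt0 one_sub_normsq_b ltr_wpDr //.
  by rewrite mulr_ge0 ?normsq_ge0 // mulr_ge0 ?subr_ge0 ?ltW.
by rewrite mulr_gt0 // subr_gt0 normsq_alpha_lt1.
Qed.

Lemma b_neq1 : b != 1.
Proof.
apply/eqP => b1; have := normsq_b_lt1.
by rewrite b1 /normsq /= expr0n /= addr0 expr1n ltxx.
Qed.

Lemma FfracE z : 1 - b * z != 0 ->
  Ffrac b g k z = z * (g - alpha * z) / (1 - b * z).
Proof. by move=> z0; rewrite /Ffrac /pole /k; field. Qed.

Lemma quotient_Ffrac z : 1 - z != 0 -> 1 - alpha * z != 0 -> 1 - b * z != 0 ->
  (Hfun alpha w z - 1) / (Hfun alpha w z + 1) = Ffrac b g k z.
Proof.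
move=> z1 z2 z3; rewrite FfracE //.
have h1 : Hfun alpha w z - 1 = 2 * (z * (g - alpha * z)) / ((1 - z) * (1 - alpha * z)).
  by rewrite /Hfun /g wC1; field; rewrite z1 z2.
have h2 : Hfun alpha w z + 1 = 2 * (1 - b * z) / ((1 - z) * (1 - alpha * z)).
  by rewrite /Hfun /b wC1; field; rewrite z1 z2.
rewrite h1 h2; field.
by rewrite z1 z2 z3.
Qed.

Lemma Ffun_Ffrac z : 1 - b * z != 0 -> Ffun alpha w z = Ffrac b g k z.
Proof.
move=> z0; apply: cvg_lim; first exact: norm_hausdorff.
have hc : Ffrac b g k u @[u --> z^'] --> Ffrac b g k z.
  exact: cvg_within_filter (Ffrac_continuous z0).
apply: cvg_trans hc; apply: near_eq_cvg; near=> u.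
apply/esym/quotient_Ffrac.
- by rewrite -[u]mul1r; near: u; exact: near_punctured_one_sub_neq0.
- by near: u; exact: near_punctured_one_sub_neq0.
- by near: u; exact: near_punctured_one_sub_neq0.
Unshelve. all: by end_near. Qed.

Lemma Ffun_derivable z : 1 - b * z != 0 -> derivable (Ffun alpha w) z 1.
Proof.
move=> z0; have [h _] := is_derive_Ffrac g k z0.
apply: near_eq_derivable h; near=> u; apply/esym/Ffun_Ffrac.
by near: u; exact: near_one_sub_neq0.
Unshelve. all: by end_near. Qed.

Lemma Ffun_continuous z : 1 - b * z != 0 -> {for z, continuous (Ffun alpha w)}.
Proof.
move=> z0; apply: differentiable_continuous; apply/derivable1_diffP.
exact: Ffun_derivable.
Qed.

(** This is |H + 1|^2 - |H - 1|^2 = 4 Re H after multiplication by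
    |(1 - z)(1 - alpha z)|^2 / 4, where Re H is a convex combination of
    (1 - |u|^2) / |1 - u|^2 at u = z and u = alpha z; cleared of denominators it
    also holds at the poles of H. *)
Lemma schur_identity z :
  normsq (1 - b * z) - normsq (z * (g - alpha * z)) =
  w * (1 - normsq z) * normsq (1 - alpha * z)
  + (1 - w) * (1 - normsq alpha * normsq z) * normsq (1 - z).
Proof.
by rewrite /b /g; case: alpha => x y; case: z => p q; rewrite /normsq /=; ring.
Qed.

Lemma normsq_Ffrac z : 1 - b * z != 0 ->
  normsq (Ffrac b g k z) = normsq (z * (g - alpha * z)) / normsq (1 - b * z).
Proof.
move=> z0; rewrite FfracE // normsqM; congr (_ * _).
have n0 : normsq (1 - b * z) != 0 by rewrite normsq_eq0.
apply: (mulIf n0); rewrite -normsqM mulVf // mulVf //.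
by rewrite /normsq /= expr0n /= addr0 expr1n.
Qed.

Lemma normsq_Ffrac_le1 z : normsq z <= 1 -> normsq (Ffrac b g k z) <= 1.
Proof.
move=> z1; have z0 := one_sub_neq0 normsq_b_lt1 z1.
rewrite normsq_Ffrac // ler_pdivrMr ?normsq_gt0 // mul1r -subr_ge0 schur_identity.
rewrite addr_ge0 // mulr_ge0 ?normsq_ge0 // mulr_ge0 ?subr_ge0 ?(ltW w0) ?(ltW w1) //.
by rewrite mulr_ile1 ?normsq_ge0 // ltW // normsq_alpha_lt1.
Qed.

Lemma normsq_Ffrac_lt1 z : normsq z = 1 -> z != 1 -> normsq (Ffrac b g k z) < 1.
Proof.
move=> z1 zn1.
have z0 : 1 - b * z != 0 by apply: (one_sub_neq0 normsq_b_lt1); rewrite z1.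
rewrite normsq_Ffrac // ltr_pdivrMr ?normsq_gt0 // mul1r -subr_gt0 schur_identity.
rewrite z1 subrr mulr0 mul0r add0r mulr1 !mulr_gt0 ?subr_gt0 ?normsq_alpha_lt1 //.
by rewrite normsq_gt0 // subr_eq0 eq_sym.
Qed.

Lemma calR_gt0 : 0 < calR (Ffun alpha w).
Proof.
have b1 := normsq_b_lt1.
rewrite (calR_Ffrac b1 Ffun_Ffrac).
have wC0 : w%:C != 0 :> C.
  by rewrite -(rmorph0 (real_complex R)) (inj_eq (@complexI R)) gt_eqF.
have lC : l%:C = (1 - w%:C) / w%:C :> C by rewrite /l -wC1 rmorphM fmorphV.
have -> : k = l%:C * (1 - b) ^+ 2 by rewrite lC /k /g /b wC1; field.
have -> : g = 1 - l%:C * (1 - b) by rewrite lC /g /b wC1; field.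
rewrite (Re_mean_eq_mean_value l b1 b_neq1).
have e0 : 0 < normsq (1 - b) by rewrite normsq_gt0 // subr_eq0 eq_sym b_neq1.
have D0 : 0 < 1 - normsq b by rewrite subr_gt0.
have le : l * normsq (1 - b) = w * (1 - w) * normsq (1 - alpha).
  have -> : 1 - b = w%:C * (1 - alpha) by rewrite /b wC1; ring.
  rewrite normsqM /l {1}/normsq /= expr0n /= addr0; field.
  by rewrite gt_eqF.
apply: mean_value_gt0 => //.
- by rewrite lerBlDr lerDl normsq_ge0.
- by rewrite divr_gt0 // mulr_gt0 // /l divr_gt0 // subr_gt0.
- rewrite ltr_pdivrMr // mul1r le one_sub_normsq_b ltrDr.
  by rewrite mulr_gt0 // subr_gt0 normsq_alpha_lt1.
- exact: ltW.
- have e1 : normsq (1 - b) != 0 by rewrite gt_eqF.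
  have -> : (1 - normsq b) ^+ 2 / normsq (1 - b) + normsq (1 - b) + 2 * (1 - normsq b)
    = ((1 - normsq b) + normsq (1 - b)) ^+ 2 / normsq (1 - b) by field.
  by rewrite ler_pdivrMr // sqr_defect_le.
Qed.

(** Radial limits on the open upper half circle are values of F, which has modulus
    less than one there; the exceptional set would contain the interval ]0, pi[. *)
Lemma Ffun_not_inner : ~ inner_function (Ffun alpha w).
Proof.
move=> [_ [A [mA A0 hA]]].
have hpi : `]0, pi[%classic `<=` A.
  move=> t /= /[!in_itv] /= /andP[t0 tpi]; apply: hA => /= ht.
  have /ht [l' lim1 l1] : `[0, 2 * pi]%classic t.
    rewrite /= in_itv /= (ltW t0) /= (le_trans (ltW tpi)) //.
    by rewrite ler_peMl // ?pi_ge0 // ler1n.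
  have tn1 : ucircle t != 1.
    apply/eqP => /(congr1 (@complex.Im R)) /=; rewrite mul1r => st.
    by have := @sin_gt0_pi R t; rewrite t0 tpi st ltxx => /(_ isT).
  have hp := one_sub_ucircle_neq0 normsq_b_lt1 t.
  have lim2 : Ffun alpha w (polar r t) @[r --> (1 : R)^'-] --> Ffun alpha w (ucircle t).
    exact: (cvg_comp _ _ (@polar_at_left R t) (Ffun_continuous hp)).
  have e := cvg_unique (@norm_hausdorff _ _) lim1 lim2.
  have : `|l'| < 1.
    by rewrite e Ffun_Ffrac // complex_norm_lt1 normsq_Ffrac_lt1 // normsq_ucircle.
  by rewrite l1 ltxx.
have : ((@lebesgue_measure R) `]0%R, pi[%classic <= (@lebesgue_measure R) A)%E.
  by apply: le_measure => //; rewrite inE //; exact: measurable_itv.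
by rewrite A0 lebesgue_measure_itv /= lte_fin pi_gt0 -EFinD subr0 lee_fin leNgt pi_gt0.
Qed.

End TwoPointFamily.

Unset Implicit Arguments.

Theorem theorem3p16 (R : realType) (alpha : R[i]) (w : R)
    (halpha : unit_disk alpha) (hw0 : 0 < w) (hw1 : w < 1) :
  (forall z, unit_disk z ->
     Ffun alpha w z = (Hfun alpha w z - 1) / (Hfun alpha w z + 1)) /\
  analytic_near_closed_disk (Ffun alpha w) /\
  schur_function (Ffun alpha w) /\
  ~ inner_function (Ffun alpha w) /\
  Ffun alpha w 0 = 0 /\
  Ffun alpha w 1 = 1 /\
  0 < calR (Ffun alpha w).
Proof.
have b1 := normsq_b_lt1 halpha hw0 hw1.
have reg z : normsq z <= 1 -> 1 - (w%:C * alpha + (1 - w)%:C) * z != 0.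
  exact: one_sub_neq0.
have a0 := normsq_alpha_lt1 halpha.
have one_le1 : normsq (1 : R[i]) <= 1 by rewrite /normsq /= expr0n /= addr0 expr1n.
have ana : analytic_on unit_disk (Ffun alpha w).
  move=> z; rewrite /unit_disk /= complex_norm_lt1 => /ltW z1.
  by apply: Ffun_derivable; exact: reg.
split=> [z|].
  rewrite /unit_disk /= complex_norm_lt1 => z1.
  rewrite Ffun_Ffrac ?reg ?ltW // quotient_Ffrac ?reg ?ltW //.
    by have := one_sub_neq0 z1 one_le1; rewrite mulr1.
  by apply: one_sub_neq0 => //; exact: ltW.
split.
  exists [set z | 1 - (w%:C * alpha + (1 - w)%:C) * z != 0]; split.
  - exact: open_one_sub_neq0.
  - by move=> z; rewrite /closed_unit_disk /= complex_norm_le1; exact: reg.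
  - by move=> z; exact: Ffun_derivable.
split; first split => //.
  move=> z; rewrite /unit_disk /= complex_norm_lt1 => /ltW z1.
  by rewrite complex_norm_le1 Ffun_Ffrac ?reg // normsq_Ffrac_le1.
split; first exact: Ffun_not_inner.
split.
  rewrite Ffun_Ffrac ?reg ?FfracE ?reg ?mul0r ?mul0r //.
    by rewrite /normsq /= expr0n /= addr0.
  by rewrite /normsq /= expr0n /= addr0.
split; last exact: calR_gt0.
rewrite Ffun_Ffrac ?reg // FfracE ?reg // mul1r !mulr1.
have r1 := reg _ one_le1; rewrite mulr1 in r1.
rewrite -[RHS](divff r1); congr (_ / _).
by rewrite rmorphB; ring.
Qed.
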